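(* Let $P(T,X)=X^6+T^6-1\in\mathbf{Q}[T,X]$. For $t\in\mathbf{Q}$, the specialized polynomial $P_t=P(t,X)=X^6+t^6-1$ is reducible in $\mathbf{Q}[X]$ if and only if $t\in\{0,1,-1\}$. *)

(* Defs.v *)
From mathcomp Require Import all_boot all_order all_algebra.

Set Implicit Arguments.
Unset Strict Implicit.
Unset Printing Implicit Defensive.

Import GRing.Theory.
Local Open Scope ring_scope.

(* Q[T, X] is encoded as Q[T][X]: the outer variable is X, the coefficients
   are polynomials in T. *)
Definition P : {poly {poly rat}} := 'X^6 + ('X^6)%:P - 1.

(* P(t, X): the coefficients in Q[T] are evaluated at T = t. *)
Definition P_at (t : rat) : {poly rat} := map_poly (horner_eval t) P.

Lemma P_atE (t : rat) : P_at t = 'X^6 + (t ^+ 6)%:P - 1.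
Proof.
by rewrite /P_at /P rmorphB rmorphD rmorph1 /= map_polyXn map_polyC /=
           /horner_eval hornerXn.
Qed.

(* Main.v *)
Require Import Defs.
From mathcomp Require Import all_boot all_order all_algebra.
From mathcomp Require Import all_field zify ring lra.

(** Write c = 1 - t^6, so that P(t, X) = X^6 - c.

    Reducibility forces c to be a square or a cube.  Every complex root z of
    X^6 - c satisfies z^6 = c, so if q is a divisor of degree d and e is, up to
    sign, the quotient of its constant coefficient by its leading coefficient
    (the product of its roots), then e^6 = c^d with e rational.  For
    d = 1, 2, 3, 4, 5 this makes c a square or a cube
    ([dvdp_Xn_sub_norm], [irreducible_X6_sub]).

    Both possibilities give a rational point on the one elliptic curve
    y^2 = x^3 + 1.  If c = s^2, then s^2 = (-t^2)^3 + 1; if c = s^3, then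
    (t^3)^2 = (-s)^3 + 1.  Euler showed that the affine rational points of this
    curve have x = -1, 0 or 2 ([Euler_cubic]).  In the first case -t^2 = 2 is
    impossible and the other two values give t = 0, 1, -1.  In the second case
    x = 2 would give t^6 = 9, and x = -1, 0 give t^6 = 0, 1.

    Euler's theorem is a descent through a 2-isogeny.  Writing x + 1 = n/m in
    lowest terms, n m (n^2 - 3nm + 3m^2) is a square.  If 3 divides n, replacing
    (n, m) by (m, n/3) gives an equation of the same shape, so one may assume
    that it does not; the three factors are then pairwise coprime, hence squares,
    and
      c^4 - 3 b^2 c^2 + 3 b^4 = d^2,       n = c^2, m = b^2.
    Completing the square and factoring the difference of two squares produces
    the quartic of the isogenous curve,
      C^2 = u^4 + 6 u^2 v^2 - 3 v^4,
    with b equal to u v or 2 u v ([quartic_to_dual]).  Doing the same to this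
    one returns to the first quartic, with b replaced by a divisor s of v
    ([descent_from_dual]).  So b decreases, except at the trivial solution
    b = c = 1 ([quartic_trivial]). *)

Import Order.TTheory GRing.Theory Num.Theory.
Local Open Scope ring_scope.

(** * Coprime factors of powers *)

Lemma coprime_of_prime (a b : nat) :
  (forall p, prime p -> p %| a -> p %| b -> False)%N -> coprime a b.
Proof.
move=> no_p; have [g1|g1|g0] := ltngtP (gcdn a b) 1; last by rewrite /coprime g0.
  have /eqP : gcdn a b = 0%N by case: (gcdn a b) g1.
  rewrite -leqn0 leqNgt gcdn_gt0 negb_or -!leqNgt !leqn0 => /andP[/eqP a0 /eqP b0].
  by case: (no_p 2%N); rewrite // ?a0 ?b0.
case: (no_p _ (pdiv_prime g1)).
- exact: dvdn_trans (pdiv_dvd _) (dvdn_gcdl _ _).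
- exact: dvdn_trans (pdiv_dvd _) (dvdn_gcdr _ _).
Qed.

Lemma coprime_common_prime (a b p : nat) :
  (coprime a b -> prime p -> p %| a -> p %| b -> False)%N.
Proof.
move=> /eqP co_ab p_pr pa pb; have : (p %| gcdn a b)%N by rewrite dvdn_gcd pa.
by rewrite co_ab dvdn1 => /eqP p1; rewrite p1 in p_pr.
Qed.

(** The roots are the gcds of the two factors with k: coprimality of a and b
    makes these multiply to k, and each n-th power divides its factor. *)
Lemma coprime_mul_eq_exp (n a b k : nat) :
  (0 < n -> coprime a b -> a * b = k ^ n ->
   exists u v, [/\ a = u ^ n, b = v ^ n & k = u * v])%N.
Proof.
move=> n_gt0 co_ab ab_eq.
have [k0 | k_gt0] := posnP k.
  (* Here one factor is 0, so coprimality makes the other one 1. *)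
  move: ab_eq; rewrite k0 exp0n // => /eqP; rewrite muln_eq0.
  case/orP=> /eqP z0; move: co_ab; rewrite z0 /coprime ?gcd0n ?gcdn0 => /eqP ->.
    by exists 0%N, 1%N; rewrite exp0n // exp1n.
  by exists 1%N, 0%N; rewrite exp0n // exp1n.
have ab_gt0 : (0 < a * b)%N by rewrite ab_eq expn_gt0 k_gt0.
have [a_gt0 b_gt0] : (0 < a /\ 0 < b)%N by apply/andP; rewrite -muln_gt0.
pose u := gcdn a k; pose v := gcdn b k.
have co_ub : coprime u b by apply: coprime_dvdl co_ab; apply: dvdn_gcdl.
have co_va : coprime v a.
  by rewrite coprime_sym; apply: coprime_dvdr co_ab; apply: dvdn_gcdl.
have co_uv : coprime u v by apply: coprime_dvdr co_ub; apply: dvdn_gcdl.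
have uvE : k = (u * v)%N.
  apply/eqP; rewrite eqn_dvd Gauss_dvd // !dvdn_gcdr !andbT.
  rewrite /u /v muln_gcdl !muln_gcdr !dvdn_gcd ab_eq.
  by rewrite dvdn_exp // dvdn_mull // !dvdn_mulr // dvdn_mull.
have ua : (u ^ n %| a)%N.
  have <- : (u ^ n %| a * b)%N = (u ^ n %| a)%N by rewrite Gauss_dvdl // coprimeXl.
  by rewrite ab_eq dvdn_exp2r // dvdn_gcdr.
have vb : (v ^ n %| b)%N.
  have <- : (v ^ n %| a * b)%N = (v ^ n %| b)%N by rewrite Gauss_dvdr // coprimeXl.
  by rewrite ab_eq dvdn_exp2r // dvdn_gcdr.
have uv_ab : (u ^ n * v ^ n = a * b)%N by rewrite -expnMn -uvE ab_eq.
exists u, v; have := dvdn_leq a_gt0 ua; have := dvdn_leq b_gt0 vb.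
by split=> //; nia.
Qed.

(** The prime 3 can only go to one of the two factors; dividing it out leaves
    coprime factors of a fourth power. *)
Lemma coprime_mul_eq_3exp4 (a b k : nat) :
  (coprime a b -> a * b = 3 * k ^ 4 ->
   exists u v, [/\ coprime u v, ~~ (3 %| u), k = u * v &
     (a = u ^ 4 /\ b = 3 * v ^ 4) \/ (a = 3 * v ^ 4 /\ b = u ^ 4)])%N.
Proof.
wlog b3 : a b / (3 %| b)%N.
  move=> IH co_ab ab_eq; have: (3 %| a * b)%N by rewrite ab_eq dvdn_mulr.
  rewrite Euclid_dvdM // => /orP[a3|b3]; last exact: IH.
  have [||u [v [co_uv u3 kE ABE]]] := IH b a a3.
  - by rewrite coprime_sym.
  - by rewrite mulnC.
  by exists u, v; split=> //; tauto.
move=> co_ab ab_eq; case/dvdnP: b3 => b' bE; move: co_ab ab_eq; rewrite {}bE.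
rewrite coprimeMr => /andP[co_ab' co_a3] ab_eq.
have [|//|u [v [aE b'E kE]]] := @coprime_mul_eq_exp 4 a b' k _ co_ab'; first by [].
  by lia.
exists u, v; split=> //; last by left; split=> //; lia.
  by move: co_ab'; rewrite aE b'E coprime_pexpl // coprime_pexpr.
by move: co_a3; rewrite aE coprime_pexpl // coprime_sym prime_coprime.
Qed.

(** The case p = 3 is included: then 9 divides 3 k^4, so 3 divides k. *)
Lemma prime_dvd_3exp4 (p a b k : nat) :
  (prime p -> p %| a -> p %| b -> a * b = 3 * k ^ 4 -> p %| k)%N.
Proof.
move=> p_pr /dvdnP[a' ->] /dvdnP[b' ->] ab_eq.
have [p3|p3] := eqVneq p 3%N.
  have : (3 %| k ^ 4)%N by apply/dvdnP; exists (a' * b')%N; subst p; lia.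
  by rewrite Euclid_dvdX // p3 => /andP[].
have : (p %| 3 * k ^ 4)%N by rewrite -ab_eq mulnA dvdn_mull.
rewrite Euclid_dvdM // dvdn_prime2 // (negPf p3) /=.
by rewrite Euclid_dvdX // => /andP[].
Qed.

(** This is the fact that -1 is not a square modulo 3. *)
Lemma dvd3_sqr_add_sqr (x y : nat) : (3 %| x ^ 2 + y ^ 2 -> 3 %| x)%N.
Proof.
move=> h.
have [q [i [xE i3]]] : exists q i, x = (3 * q + i)%N /\ (i < 3)%N.
  by exists (x %/ 3)%N, (x %% 3)%N; split; lia.
have [q' [i' [yE i'3]]] : exists q i, y = (3 * q + i)%N /\ (i < 3)%N.
  by exists (y %/ 3)%N, (y %% 3)%N; split; lia.
move: h; rewrite xE yE.
case: i i3 {xE} => [|[|[|]]] // _; case: i' i'3 {yE} => [|[|[|]]] // _; lia.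
Qed.

(** * Descent on the quartics *)

(** Splitting a b = 3 k^4 into coprime factors gives {u^4, 3 v^4} in one of the
    two orders; modulo 3, the order with a = u^4 would make C^2 + u^4 vanish, so
    that 3 would divide C. *)
Lemma descent_to_dual (k C a b : nat) :
  (coprime a b -> a * b = 3 * k ^ 4 -> b + 6 * k ^ 2 = a + C ^ 2 -> ~~ (3 %| C) ->
   exists u v, [/\ coprime u v, k = u * v &
     C ^ 2 + 3 * v ^ 4 = u ^ 4 + 6 * u ^ 2 * v ^ 2])%N.
Proof.
move=> co_ab ab_eq bE C3.
have [u [v [co_uv u3 kE [[aE b_E]|[aE b_E]]]]] := coprime_mul_eq_3exp4 _ _ _ co_ab ab_eq.
  case/negP: C3; apply: (@dvd3_sqr_add_sqr _ (u ^ 2)).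
  by apply/dvdnP; exists (v ^ 4 + 2 * k ^ 2)%N; lia.
by exists u, v; split=> //; subst k; lia.
Qed.

(** With W = u^2 + 3 v^2 the hypothesis reads (W - C)(W + C) = 12 v^4.  The two
    factors have the same parity and their halves e, f are coprime, since a
    common prime would divide v and W, hence u.  So {e, f} = {r^4, 3 s^4}, and
    the conclusion is the equation e + f = W, symmetric in e and f. *)
Lemma descent_from_dual (u v C : nat) :
  (coprime u v -> C ^ 2 + 3 * v ^ 4 = u ^ 4 + 6 * u ^ 2 * v ^ 2 ->
   exists r s, [/\ coprime r s, ~~ (3 %| r), v = r * s &
     r ^ 4 + 3 * s ^ 4 = u ^ 2 + 3 * s ^ 2 * r ^ 2])%N.
Proof.
move=> co_uv CE.
pose W := (u ^ 2 + 3 * v ^ 2)%N.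
have WC : (W ^ 2 = C ^ 2 + 12 * v ^ 4)%N by rewrite /W; lia.
have leCW : (C <= W)%N by nia.
have [e [f [WE CfE]]] : exists e f, (W = e + f /\ C + e = f)%N.
  exists ((W - C)./2)%N, ((W + C)./2)%N.
  have : odd (W ^ 2) = odd (C ^ 2) by rewrite WC oddD oddM addbF.
  rewrite !oddX /=; lia.
have efE : (e * f = 3 * v ^ 4)%N by move: WC; rewrite WE -CfE; lia.
have co_ef : coprime e f.
  apply: coprime_of_prime => p p_pr pe pf.
  have pv := prime_dvd_3exp4 _ _ _ _ p_pr pe pf efE.
  have : (p %| W)%N by rewrite WE dvdn_add.
  rewrite /W dvdn_addl; last by rewrite dvdn_mull // dvdn_exp.
  rewrite Euclid_dvdX // => /andP[pu _].
  exact: coprime_common_prime co_uv p_pr pu pv.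
have [r [s [co_rs r3 vE efE']]] := coprime_mul_eq_3exp4 _ _ _ co_ef efE.
exists r, s; split=> //.
by move: WE; rewrite /W vE; case: efE' => [] [-> ->]; lia.
Qed.

(** This is d^2 - (x - y)^2 = (d - (x - y)) (d + (x - y)), stated with sums
    because x - y can have either sign. *)
Lemma sqr_sub_sqr_factor (d x y M : nat) :
  (d ^ 2 + 2 * x * y = x ^ 2 + y ^ 2 + M ->
   exists A B, [/\ A + x = d + y, B + y = d + x & A * B = M])%N.
Proof.
wlog le_xy : x y / (x <= y)%N.
  move=> IH dE; have [/IH|/ltnW/IH] := leqP x y; first exact.
  by case=> [|A [B [AE BE ABE]]]; [lia | exists B, A; split=> //; lia].
rewrite -(subnK le_xy); move: (y - x)%N => z dE.
have le_zd : (z <= d)%N by rewrite leqNgt; apply/negP => lt_dz; nia.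
rewrite -(subnK le_zd) in dE *; move: (d - z)%N dE => w dE.
by exists (w + 2 * z)%N, w; split; lia.
Qed.

(** Four times the hypothesis is (2d)^2 - (2c^2 - 3b^2)^2 = 3 b^4.  For odd b
    the two factors on the left are coprime.  For b = 2k, d and c are odd,
    d^2 - (c^2 - 6k^2)^2 = 12 k^4, and the halves of the factors are coprime
    with product 3 k^4. *)
Lemma quartic_to_dual (b c d : nat) :
  (coprime b c -> ~~ (3 %| c) -> c ^ 4 + 3 * b ^ 4 = d ^ 2 + 3 * b ^ 2 * c ^ 2 ->
   exists u v C, [/\ coprime u v,
     C ^ 2 + 3 * v ^ 4 = u ^ 4 + 6 * u ^ 2 * v ^ 2 &
     (b = u * v /\ C = 2 * c) \/ (b = 2 * (u * v) /\ C = c)])%N.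
Proof.
move=> co_bc c3 dE.
have absurd p := @coprime_common_prime b c p co_bc.
have [b_odd|b_even] := boolP (odd b).
- have [|A [B [AE BE ABE]]] :=
    sqr_sub_sqr_factor (2 * d) (2 * c ^ 2) (3 * b ^ 2) (3 * b ^ 4).
    by transitivity (4 * (d ^ 2 + 3 * b ^ 2 * c ^ 2))%N; [ring | rewrite -dE; ring].
  have co_AB : coprime A B.
    apply: coprime_of_prime => p p_pr pA pB.
    have pb := prime_dvd_3exp4 _ _ _ _ p_pr pA pB ABE.
    apply: (absurd p p_pr pb).
    have p2 : p != 2%N by apply: contraL pb => /eqP->; rewrite dvdn2 b_odd.
    have : (p %| 4 * c ^ 2)%N.
      have : (p %| B + 6 * b ^ 2)%N by rewrite dvdn_add // dvdn_mull // dvdn_exp.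
      have -> : (B + 6 * b ^ 2 = A + 4 * c ^ 2)%N by clear -AE BE; lia.
      by rewrite dvdn_addr.
    rewrite (_ : 4 = 2 ^ 2)%N // -expnMn Euclid_dvdX // => /andP[+ _].
    by rewrite Euclid_dvdM // dvdn_prime2 // (negPf p2).
  have [||u [v [co_uv bE CE]]] := descent_to_dual b (2 * c) _ _ co_AB ABE.
  - by clear -AE BE; lia.
  - by rewrite Euclid_dvdM.
  by exists u, v, (2 * c)%N; split=> //; left.
- have [k bE] : exists k, b = (2 * k)%N by exists b./2; lia.
  have c_odd : odd c.
    by apply/negPn/negP => c_even; apply: (absurd 2%N); rewrite // dvdn2.
  have d_odd : odd d.
    have := congr1 odd dE.
    by rewrite !(oddD, oddM, oddX) (negPf b_even) c_odd /=; case: (odd d).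
  have c2_odd : odd (c ^ 2) by rewrite oddX.
  subst b.
  have [|A' [B' [AE' BE' ABE']]] :=
    sqr_sub_sqr_factor d (c ^ 2) (6 * k ^ 2) (12 * k ^ 4).
    by transitivity (d ^ 2 + 3 * (2 * k) ^ 2 * c ^ 2)%N; [ring | rewrite -dE; ring].
  have [A AE] : exists A, A' = (2 * A)%N by clear -AE' c2_odd d_odd; exists A'./2; lia.
  have [B BE] : exists B, B' = (2 * B)%N by clear -BE' c2_odd d_odd; exists B'./2; lia.
  subst A' B'.
  have ABE : (A * B = 3 * k ^ 4)%N by clear -ABE'; lia.
  have co_AB : coprime A B.
    apply: coprime_of_prime => p p_pr pA pB.
    have pk := prime_dvd_3exp4 _ _ _ _ p_pr pA pB ABE.
    apply: (absurd p p_pr); first by rewrite dvdn_mull.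
    have : (p %| c ^ 2)%N.
      have : (p %| B + 6 * k ^ 2)%N by rewrite dvdn_add // dvdn_mull // dvdn_exp.
      have -> : (B + 6 * k ^ 2 = A + c ^ 2)%N by clear -AE' BE'; lia.
      by rewrite dvdn_addr.
    by rewrite Euclid_dvdX // => /andP[].
  have [|//|u [v [co_uv kE CE]]] := descent_to_dual k c _ _ co_AB ABE.
  - by clear -AE' BE'; lia.
  by exists u, v, c; split=> //; right; split=> //; rewrite kE.
Qed.

(** Infinite descent on b.  The composite of the two steps yields a solution
    (s, r) of the same quartic with b = u r s or b = 2 u r s.  Both when s < b, by
    induction, and when s = b, directly, it follows that r = s = 1; going back
    up, u = v = 1 and C = 2, which is b = c = 1 if C = 2c, and b = c = 2 if C = c.
    The second pair is not coprime, but it satisfies the conclusion as well. *)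
Lemma quartic_trivial (b c d : nat) :
  (coprime b c -> ~~ (3 %| c) -> c ^ 4 + 3 * b ^ 4 = d ^ 2 + 3 * b ^ 2 * c ^ 2 ->
   b = 0 \/ b = c)%N.
Proof.
elim/ltn_ind: b c d => b IH c d co_bc c3 dE.
have [->|b_gt0] := posnP b; first by left.
right.
have [u [v [C [co_uv CE bCE]]]] := quartic_to_dual _ _ _ co_bc c3 dE.
have [r [s [co_rs r3 vE uE]]] := descent_from_dual _ _ _ co_uv CE.
have uv_gt0 : (0 < u * v)%N by clear -b_gt0 bCE; lia.
have [u_gt0 v_gt0] : (0 < u /\ 0 < v)%N by apply/andP; rewrite -muln_gt0.
have [r_gt0 s_gt0] : (0 < r /\ 0 < s)%N by apply/andP; rewrite -muln_gt0 -vE.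
have [rs1 us1] : (r = 1 /\ s = 1)%N.
  have [lt_sb|le_bs] := ltnP s b.
    have co_sr : coprime s r by rewrite coprime_sym.
    have [s0|sr] := IH s lt_sb r u co_sr r3 uE; first by rewrite s0 in s_gt0.
    by move: co_rs; rewrite sr /coprime gcdnn => /eqP.
  have le_urs : (u * (r * s) <= s)%N by rewrite -vE; clear -le_bs bCE; lia.
    have : (u * r <= 1)%N by rewrite -(leq_pmul2r s_gt0) mul1n -mulnA.
    rewrite leq_eqVlt ltnS leqn0 muln_eq0 !eqn0Ngt u_gt0 r_gt0 orbF muln_eq1.
    case/andP=> /eqP u1 /eqP r1.
    by split=> //; move: uE; rewrite r1 u1; clear -s_gt0; nia.
have u1 : (u = 1)%N by move: uE; rewrite rs1 us1; clear; nia.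
have C2 : (C = 2)%N by move: CE; rewrite vE rs1 us1 u1; clear; nia.
by case: bCE; rewrite vE rs1 us1 u1 C2; clear; lia.
Qed.

(** * Rational points on the curve y^2 = x^3 + 1 *)

(** Here Q stands for n^2 - 3nm + 3m^2.  As 3 does not divide n, the factors n,
    m, Q are pairwise coprime, hence all squares. *)
Lemma cubic_form_sqr_prime3 (m n Q N : nat) :
  (coprime m n -> ~~ (3 %| n) -> Q + 3 * n * m = n ^ 2 + 3 * m ^ 2 ->
   n * m * Q = N ^ 2 -> m = 0 \/ m = n)%N.
Proof.
move=> co_mn n3 QE NE.
have absurd p := @coprime_common_prime m n p co_mn.
have co_nQ : coprime n Q.
  apply: coprime_of_prime => p p_pr pn pQ; apply: (absurd p) => //.
  have : (p %| n ^ 2 + 3 * m ^ 2)%N by rewrite -QE dvdn_add // dvdn_mulr // dvdn_mull.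
  rewrite dvdn_addr ?dvdn_exp // Euclid_dvdM // Euclid_dvdX //.
  case/orP=> [|/andP[] //]; rewrite dvdn_prime2 // => /eqP p3.
  by rewrite -p3 pn in n3.
have co_mQ : coprime m Q.
  apply: coprime_of_prime => p p_pr pm pQ; apply: (absurd p) => //.
  have : (p %| n ^ 2 + 3 * m ^ 2)%N by rewrite -QE dvdn_add // dvdn_mull.
  rewrite dvdn_addl; last by rewrite dvdn_mull // dvdn_exp.
  by rewrite Euclid_dvdX // => /andP[].
have [//||nm [d [nmE dE _]]] := @coprime_mul_eq_exp 2 (n * m) Q N _ _ NE.
  by rewrite coprimeMl co_nQ.
have [//||c [b [cE bE _]]] := @coprime_mul_eq_exp 2 n m nm _ _ nmE.
  by rewrite coprime_sym.
subst n m Q.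
have [|||b0|bc] := quartic_trivial b c d.
- by move: co_mn; rewrite coprime_pexpl // coprime_pexpr.
- by apply: contra n3 => c3; rewrite dvdn_exp.
- by clear -QE; lia.
- by left; rewrite b0.
- by right; rewrite bc.
Qed.

(** If n = 3k, then n m (n^2 - 3nm + 3m^2) = 9 m k (m^2 - 3mk + 3k^2), the form
    at (m, k); as 3 does not divide m, the previous case applies. *)
Lemma cubic_form_sqr (m n Q N : nat) :
  (0 < m -> coprime m n -> Q + 3 * n * m = n ^ 2 + 3 * m ^ 2 ->
   n * m * Q = N ^ 2 -> [\/ n = 0, n = m | n = 3 * m])%N.
Proof.
move=> m_gt0 co_mn QE NE.
have [/dvdnP[k nE]|n3] := boolP (3 %| n)%N; last first.
  have [m0|->] := cubic_form_sqr_prime3 _ _ _ _ co_mn n3 QE NE.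
    by rewrite m0 in m_gt0.
  by constructor 2.
subst n; have [m3 co_mk] : (~~ (3 %| m) /\ coprime k m)%N.
  move: co_mn; rewrite coprimeMr coprime_sym => /andP[-> ].
  by rewrite coprime_sym prime_coprime.
have /dvdnP[M NM] : (3 %| N)%N.
  have : (3 %| N ^ 2)%N by rewrite -NE -!mulnA dvdn_mull // dvdn_mulr.
  by rewrite Euclid_dvdX // => /andP[].
subst N.
have [P PE] : exists P, Q = (3 * P)%N.
  by exists (Q %/ 3)%N; clear -QE; lia.
subst Q.
have [||->|->] := cubic_form_sqr_prime3 k m P M co_mk m3.
- by clear -QE; lia.
- by clear -NE; lia.
- by constructor 1.
- by constructor 3; rewrite mulnC.
Qed.

(** With X = x + 1 the curve is y^2 = X (X^2 - 3X + 3), whose quadratic factor is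
    positive.  For X = n/m and y = p/q in lowest terms, clearing denominators
    gives (p m^2)^2 = q^2 n m (n^2 - 3nm + 3m^2), so that q divides p m^2 and
    n m (n^2 - 3nm + 3m^2) is the square of an integer. *)
Lemma Euler_cubic (x y : rat) : y ^+ 2 = x ^+ 3 + 1 -> x \in [:: -1; 0; 2].
Proof.
pose X := x + 1 => yE.
have XE : y ^+ 2 = X * (X ^+ 2 - 3 * X + 3) by rewrite yE /X; ring.
have X_ge0 : 0 <= X.
  rewrite leNgt; apply/negP => X_lt0.
  have := sqr_ge0 y; rewrite XE leNgt nmulr_rlt0 // => /negP; apply.
  by nra.
pose n := `|numq X|%N; pose m := `|denq X|%N.
pose p := `|numq y|%N; pose q := `|denq y|%N.
have m_gt0 : (0 < m)%N by rewrite absz_gt0 denq_neq0.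
have q_gt0 : (0 < q)%N by rewrite absz_gt0 denq_neq0.
have co_mn : coprime m n by rewrite coprime_sym coprime_num_den.
have Xnm : X = n%:R / m%:R.
  by rewrite -[LHS]divq_num_den /n /m !natr_absz !ger0_norm ?numq_ge0 //.
have ypq : y ^+ 2 = (p%:R / q%:R) ^+ 2.
  rewrite -{1}[y]divq_num_den /p /q !natr_absz.
  by rewrite !expr_div_n !intr_norm !real_normK ?num_real.
have [Q QE] : exists Q, (Q + 3 * n * m = n ^ 2 + 3 * m ^ 2)%N.
  exists (n ^ 2 + 3 * m ^ 2 - 3 * n * m)%N; rewrite subnK //.
  (* 4 (n^2 - 3nm + 3m^2) = (2n - 3m)^2 + 3m^2 is nonnegative. *)
  by have := (nat_Cauchy (2 * n) (3 * m)).1; clear; lia.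
have m0 : m%:R != 0 :> rat by rewrite pnatr_eq0 -lt0n.
have q0 : q%:R != 0 :> rat by rewrite pnatr_eq0 -lt0n.
have NE : ((p * m ^ 2) ^ 2 = q ^ 2 * (n * m * Q))%N.
  apply/eqP; rewrite -(eqr_nat rat) !(natrM, natrX).
  have -> : Q%:R = n%:R ^+ 2 + 3 * m%:R ^+ 2 - 3 * n%:R * m%:R :> rat.
    have /(congr1 (fun k => k%:R : rat)) := QE.
    by rewrite !(natrD, natrM, natrX) => <-; ring.
  move: XE; rewrite ypq Xnm => XE.
  apply/eqP; transitivity (q%:R ^+ 2 * m%:R ^+ 4 * (p%:R / q%:R) ^+ 2 : rat).
    by field.
  by rewrite XE; field.
have /dvdnP[N pmE] : (q %| p * m ^ 2)%N.
  by rewrite -(@dvdn_pexp2r _ _ 2) // NE dvdn_mulr.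
have {}NE : (n * m * Q = N ^ 2)%N.
  apply/eqP; rewrite -(@eqn_pmul2l (q ^ 2)) ?expn_gt0 ?q_gt0 //.
  by rewrite -NE pmE expnMn mulnC.
have xE : x = n%:R / m%:R - 1 by rewrite -Xnm /X addrK.
rewrite !inE xE; case: (cubic_form_sqr _ _ _ _ m_gt0 co_mn QE NE) => ->.
- by rewrite mul0r sub0r eqxx.
- by rewrite divff // subrr eqxx orbT.
- by rewrite natrM mulfK // orbC.
Qed.

(** The 3-adic valuation of a sixth power is a multiple of 6, that of 9 is 2. *)
Lemma rat_exp6_neq9 (z : rat) : z ^+ 6 != 9.
Proof.
apply/eqP => zE.
pose p := `|numq z|%N; pose q := `|denq z|%N.
have q_gt0 : (0 < q)%N by rewrite absz_gt0 denq_neq0.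
have q0 : q%:R != 0 :> rat by rewrite pnatr_eq0 -lt0n.
have zpq : `|z| = p%:R / q%:R.
  by rewrite -{1}[z]divq_num_den normf_div /p /q !natr_absz !intr_norm.
have pqE : (p ^ 6 = 3 ^ 2 * q ^ 6)%N.
  apply/eqP; rewrite -(eqr_nat rat) !(natrM, natrX); apply/eqP.
  have : `|z| ^+ 6 = 9 by rewrite -normrX zE ger0_norm.
  rewrite zpq expr_div_n => /(canRL (divfK _)) ->; last exact: expf_neq0.
  by congr (_ * _); ring.
have := congr1 (logn 3) pqE.
rewrite lognM ?expn_gt0 ?q_gt0 // !lognX (_ : logn 3 3 = 1%N) //.
clear; lia.
Qed.

(** * Reducibility of X^6 - c *)

(** The expression raised to the n-th power is the product of the complex roots
    of q, and each of those (size q).-1 roots has n-th power c. *)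
Lemma dvdp_Xn_sub_norm (n : nat) (c : rat) (q : {poly rat}) :
  (0 < n)%N -> q %| 'X^n - c%:P ->
  ((-1) ^+ (size q).-1 * (q`_0 / lead_coef q)) ^+ n = c ^+ (size q).-1.
Proof.
move=> n_gt0 q_dvd.
have p0 : 'X^n - c%:P != 0 by rewrite -size_poly_eq0 size_XnsubC.
have q0 : q != 0 by apply: contraTneq q_dvd => ->; rewrite dvd0p.
pose f : {rmorphism rat -> algC} := ratr.
have [rs rsE] := closed_field_poly_normal (map_poly f q).
have lq0 : lead_coef (map_poly f q) != 0 by rewrite lead_coef_eq0 map_poly_eq0.
have size_rs : size rs = (size q).-1.
  by rewrite -(size_map_poly f) rsE size_scale // size_prod_XsubC.
have root_rs z : z \in rs -> z ^+ n = f c.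
  move=> z_rs; have : root (map_poly f ('X^n - c%:P)) z.
    have : map_poly f q %| map_poly f ('X^n - c%:P) by rewrite dvdp_map.
    by move/dvdpP => [g ->]; rewrite rootM rsE rootZ // root_prod_XsubC z_rs orbT.
  rewrite rmorphB /= map_polyXn map_polyC /= /root !hornerE subr_eq0.
  by move/eqP.
have c0E : (map_poly f q)`_0 =
    lead_coef (map_poly f q) * ((-1) ^+ size rs * \prod_(z <- rs) z).
  by rewrite {1}rsE coefZ coef0_prod_XsubC.
apply: (fmorph_inj f).
rewrite !rmorphXn rmorphM rmorphXn rmorphN1 fmorph_div -lead_coef_map -coef_map c0E.
rewrite [_ / _]mulrC mulKf // size_rs signrMK -prodrXl.
rewrite big_seq (eq_bigr _ root_rs) -big_seq big_const_seq count_predT iter_mulr_1.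
by rewrite size_rs.
Qed.

(** For a divisor of degree d with 0 < d < 6 and e the product of its roots,
    e^6 = c^d reads: c = (e^3)^2; c = (+-e)^3; c = (e^3/c)^2; c = (+-c/e)^3;
    c = ((c/e)^3)^2. *)
Lemma irreducible_X6_sub (c : rat) :
  (forall s, c != s ^+ 2) -> (forall s, c != s ^+ 3) ->
  irreducible_poly ('X^6 - c%:P).
Proof.
move=> c2 c3; split=> [|q q1 q_dvd]; first by rewrite size_XnsubC.
have p0 : 'X^6 - c%:P != 0 by rewrite -size_poly_eq0 size_XnsubC.
have q0 : q != 0 by apply: contraTneq q_dvd => ->; rewrite dvd0p.
rewrite -(dvdp_size_eqp q_dvd) size_XnsubC //.
have := dvdp_leq p0 q_dvd; rewrite size_XnsubC //.
have := @dvdp_Xn_sub_norm 6 c q isT q_dvd; move: (_ * _) => e.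
rewrite -size_poly_eq0 in q0.
have c0 : c != 0 by have := c2 0; rewrite expr0n.
case: (size q) q0 q1 => [|[|[|[|[|[|[|[|k]]]]]]]] //= _ _ eE _.
- by case/eqP: (c2 (e ^+ 3)); rewrite -exprM eE.
- have /eqP : (e ^+ 3) ^+ 2 = c ^+ 2 by rewrite -exprM.
  rewrite eqf_sqr => /orP[]/eqP h; [case/eqP: (c3 e) | case/eqP: (c3 (- e))] => //.
  by rewrite exprNn h; ring.
- case/eqP: (c2 (e ^+ 3 / c)); rewrite expr_div_n -exprM eE; field; exact: c0.
- have /eqP : (e ^+ 3) ^+ 2 = (c ^+ 2) ^+ 2 by rewrite -!exprM.
  rewrite eqf_sqr => /orP[]/eqP h; [case/eqP: (c3 (c / e)) | case/eqP: (c3 (- c / e))].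
    by rewrite expr_div_n h; field.
  by rewrite expr_div_n h; field.
- case/eqP: (c2 ((c / e) ^+ 3)); rewrite -exprM expr_div_n eE; field; exact: c0.
Qed.

Theorem proposition4p4 (t : rat) :
  ~ irreducible_poly (P_at t) <-> t \in [:: 0; 1; -1].
Proof.
have PE : P_at t = 'X^6 - (1 - t ^+ 6)%:P.
  by rewrite P_atE polyCB polyC1 opprB addrA.
have size_P : size (P_at t) = 7 by rewrite PE size_XnsubC.
split=> [P_red | t_in [_ irr]].
- apply: contra_notT P_red; rewrite !inE !negb_or => /and3P[t0 t1 tN1].
  have c2 s : 1 - t ^+ 6 != s ^+ 2.
    apply/eqP => sE.
    have /Euler_cubic : s ^+ 2 = (- t ^+ 2) ^+ 3 + 1 by rewrite -sE; ring.
    rewrite !inE eqr_opp sqrf_eq1 (negPf t1) (negPf tN1) oppr_eq0 expf_eq0 (negPf t0).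
    by move=> /= /eqP tE; have := sqr_ge0 t; lra.
  rewrite PE; apply: irreducible_X6_sub => // s; apply/eqP => sE.
  have /Euler_cubic : (t ^+ 3) ^+ 2 = (- s) ^+ 3 + 1.
    by rewrite exprNn -[_ ^+ 3 * _]mulrC -sE; ring.
  rewrite !inE eqr_opp oppr_eq0 eqr_oppLR => /or3P[] /eqP sE'; rewrite sE' in sE.
  + have /eqP : t ^+ 6 = 0 by move: sE; rewrite expr1n; lra.
    by rewrite expf_eq0 (negPf t0).
  + by case/eqP: (c2 0); rewrite sE !expr0n.
  + have /eqP := rat_exp6_neq9 t; apply.
    have -> : t ^+ 6 = 1 - (- 2) ^+ 3 by rewrite -sE; ring.
    by ring.
- (* At t = 0 the polynomial X^6 - 1 has root 1; at t = 1, -1 it is X^6. *)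
  have [r r_root] : exists r, root (P_at t) r.
    exists (t == 0)%:R; rewrite P_atE /root !hornerE.
    by move: t_in {PE size_P irr}; rewrite !inE => /or3P[] /eqP ->.
  have := irr ('X - r%:P); rewrite size_XsubC dvdp_XsubCl => /(_ isT r_root).
  by move/eqp_size; rewrite size_XsubC size_P.
Qed.
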